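(* Let $\mathbf X$ be a recursive ML model on a DAG $\mathcal D=(V,E)$ with ML coefficient matrix $B=(b_{ij})_{d\times d}$. Let $U\subseteq V$ be non-empty and $i\in V$. Then $$\bigvee_{j\in\mathrm{An}(i)\cap U}\frac{b_{ji}}{b_{jj}}X_j=\bigvee_{j\in\mathrm{An}^U_{\mathrm{low}}(i)}\frac{b_{ji}}{b_{jj}}X_j\quad\text{and}\quad\bigwedge_{l\in\mathrm{De}(i)\cap U}\frac{b_{ii}}{b_{il}}X_l=\bigwedge_{l\in\mathrm{De}^U_{\mathrm{high}}(i)}\frac{b_{ii}}{b_{il}}X_l .$$
   Context: Let $\mathcal D=(V,E)$ be a directed acyclic graph (DAG) with $V=\{1,\dots,d\}$. For $i\in V$, $\mathrm{pa}(i)$, $\mathrm{an}(i)$, $\mathrm{de}(i)$ are the parents, ancestors and descendants of $i$ (ancestors/descendants via directed paths of length at least one); $\mathrm{An}(i)=\mathrm{an}(i)\cup\{i\}$, $\mathrm{De}(i)=\mathrm{de}(i)\cup\{i\}$. All paths are directed of length at least one; $P_{ji}$ is the set of paths from $j$ to $i$; a path passes through all its nodes including its endpoints. A recursive max-linear (ML) model on $\mathcal D$ is a random vector $\mathbf X=(X_1,\dots,X_d)$ defined recursively by $X_i=\bigvee_{k\in \mathrm{pa}(i)} c_{ki}X_k\vee c_{ii}Z_i$, $i=1,\dots,d$, with independent non-negative random variables $Z_1,\dots,Z_d$ and positive weights $c_{ki}$, $k\in\mathrm{pa}(i)\cup\{i\}$. The weight of a path $p=[j=k_0\to\dots\to k_n=i]$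 is $d_{ji}(p)=c_{k_0,k_0}\prod_{l=0}^{n-1}c_{k_l,k_{l+1}}$. The ML coefficient matrix $B=(b_{ij})_{d\times d}$ of $\mathbf X$ is given, for $i\in V$, by $b_{ji}=\bigvee_{p\in P_{ji}}d_{ji}(p)$ for $j\in\mathrm{an}(i)$, $b_{ii}=c_{ii}$, and $b_{ji}=0$ otherwise. A path $p$ from $j$ to $i$ is max-weighted if $b_{ji}=d_{ji}(p)$. A node $j\in\mathrm{An}(i)\cap U$ is a lowest max-weighted ancestor of $i$ in $U$ if no max-weighted path from $j$ to $i$ passes through some node in $U\setminus\{j\}$; the set of these is $\mathrm{An}^U_{\mathrm{low}}(i)$. A node $l\in\mathrm{De}(i)\cap U$ is a highest max-weighted descendant of $i$ in $U$ if no max-weighted path from $i$ to $l$ passes through some node in $U\setminus\{l\}$; the set of these is $\mathrm{De}^U_{\mathrm{high}}(i)$. $\vee$ and $\wedge$ denote maximum and minimum; a maximum over the empty set is $0$ and a minimum over the empty set is $\infty$. *)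

(* Defs.v *)
From HB Require Import structures.
From mathcomp Require Import all_boot all_order all_algebra.
From mathcomp Require Import all_classical all_reals all_analysis.

Set Implicit Arguments.
Unset Strict Implicit.
Unset Printing Implicit Defensive.

Import Order.TTheory GRing.Theory Num.Theory.
Local Open Scope ring_scope.

Section Graph.
Variables (d : nat) (e : rel 'I_d).

(* The path [j = k_0 -> k_1 -> ... -> k_n = i] is encoded by its start j and
   the sequence p = [:: k_1; ...; k_n], which is non-empty (length >= 1). *)
Definition dipath (j i : 'I_d) (p : seq 'I_d) : bool :=
  [&& p != [::], path e j p & last j p == i].

Definition acyclic : Prop := forall i p, ~~ dipath i i p.

(* Bounding the length by d makes this a finite set; no path of an acyclic
   graph is lost, see dipath_dipaths. *)
Definition dipaths (j i : 'I_d) : {set d.-bseq 'I_d} :=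
  [set p : d.-bseq 'I_d | dipath j i p].

Definition pa (i : 'I_d) : {set 'I_d} := [set k | e k i].
Definition an (i : 'I_d) : {set 'I_d} := [set j | dipaths j i != finset.set0].
Definition de (i : 'I_d) : {set 'I_d} := [set l | dipaths i l != finset.set0].
Definition An (i : 'I_d) : {set 'I_d} := i |: an i.
Definition De (i : 'I_d) : {set 'I_d} := i |: de i.

Lemma acyclic_uniq j p : acyclic -> path e j p -> uniq (j :: p).
Proof.
move=> acy; elim: p j => [|k p IHp] j // ejp.
have /andP[_ kp] : e j k && path e k p by [].
rewrite cons_uniq (IHp _ kp) andbT; apply/negP => jp.
have [p1 [p2 Ep]] : exists p1 p2, k :: p = rcons p1 j ++ p2.
  by case/path.splitP: jp => p1 p2; exists p1, p2.
move: ejp; rewrite Ep cat_path => /andP[ejp1 _].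
have /negP := acy j (rcons p1 j); apply.
by rewrite /dipath ejp1 last_rcons eqxx; case: p1 {Ep ejp1}.
Qed.

Lemma dipath_dipaths j i p : acyclic -> dipath j i p ->
  exists2 q : d.-bseq 'I_d, q \in dipaths j i & p = q :> seq 'I_d.
Proof.
move=> acy jip; have /and3P[_ ejp _] := jip.
have sp : (size p <= d)%N.
  have /card_uniqP jpE := acyclic_uniq acy ejp.
  by apply: ltnW; have := max_card (mem (j :: p)); rewrite jpE card_ord.
by exists (Bseq sp); rewrite // inE.
Qed.

End Graph.

Section MaxLinear.
Variables (R : realType) (d : nat) (e : rel 'I_d) (c : 'M[R]_d).

(* zip (j :: p) p lists the edges (k_l, k_(l+1)) of the path. *)
Definition path_weight (j : 'I_d) (p : seq 'I_d) : R :=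
  c j j * \prod_(a <- zip (j :: p) p) c a.1 a.2.

(* The entry in row j and column i is b_{ji}. *)
Definition mlcoef : 'M[R]_d :=
  \matrix_(j, i)
    if j \in an e i then \big[Num.max/0]_(p in dipaths e j i) path_weight j p
    else if j == i then c i i
    else 0.

Definition max_weighted (j i : 'I_d) (p : seq 'I_d) : bool :=
  dipath e j i p && (mlcoef j i == path_weight j p).

Definition passes_through (j : 'I_d) (p : seq 'I_d) (A : {set 'I_d}) : bool :=
  [exists k in A, k \in j :: p].

Definition An_low (U : {set 'I_d}) (i : 'I_d) : {set 'I_d} :=
  [set j in An e i :&: U | ~~ [exists p : d.-bseq 'I_d,
    max_weighted j i p && passes_through j p (U :\ j)]].

Definition De_high (U : {set 'I_d}) (i : 'I_d) : {set 'I_d} :=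
  [set l in De e i :&: U | ~~ [exists p : d.-bseq 'I_d,
    max_weighted i l p && passes_through i p (U :\ l)]].

End MaxLinear.

Section Model.
Variables (dT : measure_display) (T : measurableType dT) (R : realType).
Variable P : probability T R.

Definition mutually_independent (I : finType) (Z : I -> {RV P >-> R}) : Prop :=
  forall (J : {set I}) (A : I -> set R), (forall j, measurable (A j)) ->
    P (\bigcap_(j in [set` J]) (Z j @^-1` A j))%classic
    = (\prod_(j in J) P (Z j @^-1` A j)%classic)%E.

Definition recursive_ML_model (d : nat) (e : rel 'I_d) (c : 'M[R]_d)
    (X : 'I_d -> {RV P >-> R}) : Prop :=
  (forall i k, k \in pa e i -> 0 < c k i) /\
  (forall i, 0 < c i i) /\
  exists Z : 'I_d -> {RV P >-> R},
    [/\ forall i w, 0 <= Z i w,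
        mutually_independent Z &
        forall i w, X i w =
          Num.max (\big[Num.max/0]_(k in pa e i) (c k i * X k w))
                  (c i i * Z i w)].

End Model.

(* Main.v *)
Require Import Defs.
From mathcomp Require Import all_boot all_order all_algebra.
From mathcomp Require Import all_classical all_reals all_analysis.

Set Implicit Arguments.
Unset Strict Implicit.
Unset Printing Implicit Defensive.

Import Order.TTheory GRing.Theory Num.Theory.
Local Open Scope ring_scope.

(** Put r_(ji) = b_(ji) / b_(jj), which is the largest product of edge weights
    along a path from j to i, the trivial path included.  Iterating the
    recursion along a path p from j to i gives X_i >= gain(p) X_j
    ([path_gain_le]), where gain(p) is the product of the edge weights of p.

    If a node j of U in An(i) is not lowest max-weighted, some max-weighted path from
    j to i meets U in a node k other than j; let q be its part from j to k and s
    its part from k to i.  Then r_(ji) = gain(q) gain(s), gain(s) <= r_(ki) and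
    gain(q) X_j <= X_k, whence r_(ji) X_j <= r_(ki) X_k.  So the term of j may
    be dropped in favour of that of k, a proper descendant of j.  Acyclicity
    makes such replacements stop ([dominated_by_terminal]), and they can only
    stop at a lowest max-weighted ancestor.

    The statement on minima is dual: a node k of U on a max-weighted path from
    i to l, k other than l, satisfies X_k / r_(ik) <= X_l / r_(il), and k is a
    proper ancestor of l. *)

(** * Terminal elements and reachability *)

(** Replacing an element outside L by a dominating one lowers the measure m,
    so the replacements reach L; here S is the set of nodes over which the
    extremum is taken and L the set of its lowest or highest nodes. *)
Lemma dominated_by_terminal (I : finType) (m : I -> nat) (S L : {set I})
    (le : I -> I -> Prop) :
    (forall x, le x x) -> (forall x y z, le x y -> le y z -> le x z) ->
    (forall x, x \in S -> x \notin L ->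
       exists y, [/\ y \in S, (m y < m x)%N & le x y]) ->
  forall x, x \in S -> exists2 y, y \in L & le x y.
Proof.
move=> le_refl le_trans step x; have [n] := ubnP (m x).
elim: n x => // n IHn x; rewrite ltnS => mx Sx.
case: (boolP (x \in L)) => [Lx | /(step x Sx)[y [Sy myx lexy]]].
  by exists x.
have [z Lz leyz] := IHn y (leq_trans myx mx) Sy.
by exists z => //; apply: le_trans leyz.
Qed.

Section Reachability.
Variables (d : nat) (e : rel 'I_d).
Hypothesis acy : acyclic e.

(** The length bound in [dipaths] loses no path of an acyclic graph. *)
Lemma in_an j i : (j \in an e i) <-> exists p, dipath e j i p.
Proof.
rewrite inE; split=> [/set0Pn[p] | [p /(dipath_dipaths acy)[q jiq _]]].
  by rewrite inE => jip; exists p.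
by apply/set0Pn; exists q.
Qed.

(** The trivial path, excluded from [dipath] but allowed by [connect], accounts
    for the node i itself; with it, concatenation of paths is transitivity. *)
Lemma in_An_connect j i : (j \in An e i) = connect e j i.
Proof.
apply/idP/idP => [/setU1P[-> // | /in_an[p /and3P[_ ejp /eqP jpi]]] |].
  by apply/connectP; exists p.
case/connectP=> -[|k p] ejp ->; first by rewrite setU11.
by apply/setU1P; right; apply/in_an; exists (k :: p); rewrite /dipath ejp eqxx.
Qed.

Lemma in_De_connect i l : (l \in De e i) = connect e i l.
Proof.
by rewrite -in_An_connect !in_setU1 eq_sym; congr (_ || _); rewrite !inE.
Qed.

Lemma acyclic_an i : i \notin an e i.
Proof. by apply/negP => /in_an[p]; apply/negP/acy. Qed.

Lemma connect_antisym j k : connect e j k -> connect e k j -> j = k.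
Proof.
case/connectP=> p ejp ->; case/connectP=> q ekq Ej.
case: p => [|x p] // in ejp ekq Ej *.
have /negP[] := acy j ((x :: p) ++ q).
by rewrite /dipath cat_path ejp ekq last_cat -Ej eqxx.
Qed.

(** The inclusion of descendants is strict because j itself is not reachable
    from k; this is the measure that decreases when a node is replaced by a
    proper descendant, and the next lemma is its dual. *)
Lemma card_descendants_lt j k : connect e j k -> k != j ->
  (#|connect e k| < #|connect e j|)%N.
Proof.
move=> jk kj; apply/proper_card/properP; split.
  by apply/fintype.subsetP => x; apply: connect_trans.
exists j; first exact: connect0.
by apply: contra kj => kj; rewrite (connect_antisym jk kj).
Qed.

Lemma card_ancestors_lt k l : connect e k l -> k != l ->
  (#|[pred x | connect e x k]| < #|[pred x | connect e x l]|)%N.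
Proof.
move=> kl k'l; apply/proper_card/properP; split.
  by apply/fintype.subsetP => x xk; apply: connect_trans xk kl.
exists l; first exact: connect0.
by apply: contra k'l => lk; rewrite (connect_antisym kl lk).
Qed.

End Reachability.

(** * Gains of paths and the coefficient matrix *)

Section Coefficients.
Variables (R : realType) (d : nat) (e : rel 'I_d) (c : 'M[R]_d).
Hypothesis acy : acyclic e.
Hypothesis c_edge_gt0 : forall i k, k \in pa e i -> 0 < c k i.
Hypothesis c_diag_gt0 : forall i, 0 < c i i.

(** The weight of the path without the factor of its initial node, which makes
    it multiplicative under concatenation and equal to 1 on the trivial path. *)
Definition path_gain (j : 'I_d) (p : seq 'I_d) : R :=
  \prod_(a <- zip (j :: p) p) c a.1 a.2.

Lemma path_gain_nil j : path_gain j [::] = 1.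
Proof. by rewrite /path_gain big_nil. Qed.

Lemma path_gain_cons j k p : path_gain j (k :: p) = c j k * path_gain k p.
Proof. by rewrite /path_gain /= big_cons. Qed.

Lemma path_gain_cat j p q :
  path_gain j (p ++ q) = path_gain j p * path_gain (last j p) q.
Proof.
elim: p j => [|k p IHp] j /=; first by rewrite path_gain_nil mul1r.
by rewrite !path_gain_cons IHp mulrA.
Qed.

Lemma path_gain_gt0 j p : path e j p -> 0 < path_gain j p.
Proof.
elim: p j => [|k p IHp] j /=; first by rewrite path_gain_nil.
case/andP=> ejk ekp; rewrite path_gain_cons mulr_gt0 ?IHp //.
by apply: c_edge_gt0; rewrite inE.
Qed.

Lemma path_weight_gain j p : path_weight c j p = c j j * path_gain j p.
Proof. by []. Qed.

Lemma mlcoef_diag i : mlcoef e c i i = c i i.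
Proof. by rewrite mxE (negPf (acyclic_an acy i)) eqxx. Qed.

Definition mlratio (j i : 'I_d) : R := mlcoef e c j i / mlcoef e c j j.

(** As p may be trivial, the node that splits a max-weighted path is allowed to
    be its endpoint, and no case distinction is needed when i lies in U. *)
Lemma path_gain_le_mlratio j p : path e j p ->
  path_gain j p <= mlratio j (last j p).
Proof.
rewrite /mlratio ler_pdivlMr mlcoef_diag ?c_diag_gt0 // mulrC -path_weight_gain.
case: p => [|k p] ejp.
  by rewrite mlcoef_diag path_weight_gain path_gain_nil mulr1.
have jip : dipath e j (last j (k :: p)) (k :: p) by rewrite /dipath ejp eqxx.
have jan : j \in an e (last j (k :: p)) by apply/(in_an acy); exists (k :: p).
rewrite mxE jan; have [q jiq Eq] := dipath_dipaths acy jip; rewrite Eq in jiq *.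
exact: (le_bigmax_cond _ (fun q : d.-bseq 'I_d => path_weight c j q) jiq).
Qed.

Lemma mlratio_gt0 j i : connect e j i -> 0 < mlratio j i.
Proof.
case/connectP=> p ejp ->.
exact: lt_le_trans (path_gain_gt0 ejp) (path_gain_le_mlratio ejp).
Qed.

Lemma max_weighted_mlratio j i p : max_weighted e c j i p ->
  mlratio j i = path_gain j p.
Proof.
case/andP=> _ /eqP Bji; rewrite /mlratio Bji mlcoef_diag path_weight_gain.
by rewrite mulrAC mulfV ?mul1r // gt_eqF.
Qed.

(** Cutting the path at the node of A through which it passes factors its gain,
    hence the ratio it realizes. *)
Lemma max_weighted_split j i (p : seq 'I_d) (A : {set 'I_d}) :
    max_weighted e c j i p -> passes_through j p A ->
  exists q s, [/\ last j q \in A, path e j q, path e (last j q) s,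
    last (last j q) s = i & mlratio j i = path_gain j q * path_gain (last j q) s].
Proof.
move=> mw /existsP[k /andP[Ak jpk]]; have /andP[/and3P[_ ejp /eqP jpi] _] := mw.
have Eji := max_weighted_mlratio mw.
case/splitPl: jpk => q s qk in ejp jpi Eji mw.
move: ejp; rewrite cat_path => /andP[ejq eqs].
by exists q, s; rewrite -last_cat -path_gain_cat qk in Ak *; split; rewrite // -qk.
Qed.

End Coefficients.

(** * Comparison of the terms of the maximum and of the minimum *)

Section Comparison.
Variables (R : realType) (d : nat) (e : rel 'I_d) (c : 'M[R]_d).
Hypothesis acy : acyclic e.
Hypothesis c_edge_gt0 : forall i k, k \in pa e i -> 0 < c k i.
Hypothesis c_diag_gt0 : forall i, 0 < c i i.
Variable x : 'I_d -> R.
Hypothesis x_ge0 : forall i, 0 <= x i.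
Hypothesis x_edge : forall k i, e k i -> c k i * x k <= x i.

Local Notation r := (mlratio e c).

(** The hypothesis [x_edge] is what the recursion says about a single edge; it
    is iterated along the path. *)
Lemma path_gain_le j p : path e j p -> path_gain c j p * x j <= x (last j p).
Proof.
elim: p j => [|k p IHp] j /=; first by rewrite path_gain_nil mul1r.
case/andP=> ejk ekp; apply: le_trans (IHp k ekp).
rewrite path_gain_cons mulrAC mulrC ler_wpM2l ?x_edge //.
exact/ltW/(path_gain_gt0 c_edge_gt0).
Qed.

(** With q and s the parts before and after k of a max-weighted path from j to
    i: r_(ji) x_j = gain(s) (gain(q) x_j) <= gain(s) x_k <= r_(ki) x_k. *)
Lemma An_low_dominates (U : {set 'I_d}) i j : j \in An e i :&: U ->
  exists2 k, k \in An_low e c U i & r j i * x j <= r k i * x k.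
Proof.
apply: (@dominated_by_terminal _ (fun j => #|connect e j|) _ _
          (fun j k => r j i * x j <= r k i * x k)) => [k | k l n |].
- exact: lexx.
- exact: le_trans.
move=> {}j jS; rewrite inE jS negbK => /existsP[p /andP[mw]].
case/(max_weighted_split acy c_diag_gt0 mw) => q [s].
set k := last j q => -[/setD1P[kj kU] ejq eks ksi Eji].
have jk : connect e j k by apply/connectP; exists q.
exists k; split; last 1 first.
- rewrite Eji mulrAC mulrC.
  apply: le_trans (ler_wpM2l _ (path_gain_le ejq)) _.
    exact/ltW/(path_gain_gt0 c_edge_gt0).
  by rewrite ler_wpM2r // -ksi (path_gain_le_mlratio acy c_diag_gt0).
- by rewrite inE kU (in_An_connect acy) andbT; apply/connectP; exists s.
- exact: (card_descendants_lt acy).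
Qed.

(** With q and s the parts before and after k of a max-weighted path from i to
    l: r_(il) x_k = gain(q) (gain(s) x_k) <= r_(ik) x_l. *)
Lemma De_high_dominates (U : {set 'I_d}) i l : l \in De e i :&: U ->
  exists2 k, k \in De_high e c U i & (r i k)^-1 * x k <= (r i l)^-1 * x l.
Proof.
apply: (@dominated_by_terminal _ (fun l => #|[pred y | connect e y l]|) _ _
          (fun l k => (r i k)^-1 * x k <= (r i l)^-1 * x l)) => [k | k m n km mn |].
- exact: lexx.
- exact: le_trans mn km.
move=> {}l lS; rewrite inE lS negbK => /existsP[p /andP[mw]].
case/(max_weighted_split acy c_diag_gt0 mw) => q [s].
set k := last i q => -[/setD1P[kl kU] eiq eks ksl Eil].
have ik : connect e i k by apply/connectP; exists q.
have kcl : connect e k l by apply/connectP; exists s.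
exists k; split; last 1 first.
- have rik : 0 < r i k by apply: mlratio_gt0.
  have ril : 0 < r i l by apply: mlratio_gt0 => //; apply: connect_trans kcl.
  (* Clearing denominators leaves gain(q) (gain(s) x_k) <= r_(ik) x_l. *)
  rewrite ler_pdivrMl // mulrCA ler_pdivlMl // Eil -mulrA.
  apply: ler_pM.
  + exact/ltW/(path_gain_gt0 c_edge_gt0).
  + by rewrite mulr_ge0 //; apply/ltW/(path_gain_gt0 c_edge_gt0).
  + exact: path_gain_le_mlratio.
  + by rewrite -ksl path_gain_le.
- by rewrite inE kU (in_De_connect acy) ik.
- exact: (card_ancestors_lt acy).
Qed.

End Comparison.

(** * Equality of the extrema *)

Theorem proposition6p6 (dT : measure_display) (T : measurableType dT)
    (R : realType) (P : probability T R)
    (d : nat) (e : rel 'I_d) (he : acyclic e)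
    (c : 'M[R]_d) (X : 'I_d -> {RV P >-> R})
    (hX : recursive_ML_model e c X)
    (B : 'M[R]_d) (hB : B = mlcoef e c)
    (U : {set 'I_d}) (hU : U != finset.set0) (i : 'I_d) (w : T) :
  \big[Num.max/0]_(j in An e i :&: U) (B j i / B j j * X j w)
    = \big[Num.max/0]_(j in An_low e c U i) (B j i / B j j * X j w)
  /\
  \big[mine/+oo%E]_(l in De e i :&: U) (B i i / B i l * X l w)%:E
    = \big[mine/+oo%E]_(l in De_high e c U i) (B i i / B i l * X l w)%:E.
Proof.
have [c_edge_gt0 [c_diag_gt0 [Z [Z_ge0 _ XE]]]] := hX.
have X_ge0 k : 0 <= X k w.
  by rewrite XE le_max mulr_ge0 ?orbT // ltW.
have X_edge k l : e k l -> c k l * X k w <= X l w.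
  move=> ekl; rewrite [leRHS]XE le_max; apply/orP; left.
  by apply: (le_bigmax_cond _ (fun k => c k l * X k w)); rewrite inE.
have An_sub j : j \in An_low e c U i -> j \in An e i :&: U.
  by rewrite inE => /andP[].
have De_sub l : l \in De_high e c U i -> l \in De e i :&: U.
  by rewrite inE => /andP[].
have rV l : B i i / B i l = (mlratio e c i l)^-1 by rewrite hB invf_div.
split; apply/eqP; rewrite eq_le; apply/andP; split.
- apply: bigmax_le => [|j jS]; first exact: bigmax_ge_id.
  have [k kL le_jk] := An_low_dominates he c_edge_gt0 c_diag_gt0 X_ge0 X_edge jS.
  rewrite hB; apply: le_trans le_jk _.
  exact: (le_bigmax_cond _ (fun k => mlratio e c k i * X k w) kL).
- apply: bigmax_le => [|j /An_sub jS]; first exact: bigmax_ge_id.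
  exact: (le_bigmax_cond _ (fun j => B j i / B j j * X j w) jS).
- apply: le_bigmin => [|l /De_sub lS]; first exact: leey.
  exact: (bigmin_le_cond _ (fun l => (B i i / B i l * X l w)%:E) lS).
- apply: le_bigmin => [|l lS]; first exact: leey.
  have [k kH le_kl] := De_high_dominates he c_edge_gt0 c_diag_gt0 X_ge0 X_edge lS.
  apply: le_trans (bigmin_le_cond _ (fun l => (B i i / B i l * X l w)%:E) kH) _.
  by rewrite lee_fin !rV.
Qed.
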